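(* Let $q>3$ be an odd prime power and let $G:=\mathrm{PSL}_2(q)$. Then an element $g\in G$ cannot be written as a commutator of a semisimple element and a unipotent element if and only if one of the following holds: (1) $q\equiv 1 \pmod 4$ and $g$ is a semisimple element of $q$-bad order; or (2) $q\equiv 3\pmod 4$ and $g$ is a non-split semisimple element of $q$-good order.
   Context: $\mathrm{PSL}_2(q)=\mathrm{SL}_2(\mathbb{F}_q)/\{\pm I\}$, and $\bar x$ is the image of $x\in\mathrm{SL}_2(q)$. The commutator is $[x,y]=xyx^{-1}y^{-1}$. Unipotent (respectively semisimple) elements of $\mathrm{PSL}_2(q)$ are images of unipotent (respectively semisimple) elements of $\mathrm{SL}_2(q)$; in the phrase ''commutator of a semisimple element and a unipotent element'' the semisimple element is allowed to be the identity. In conditions (1) and (2), a semisimple element means the image $\bar x\neq 1$ of a non-central semisimple $x\in\mathrm{SL}_2(q)$; it is split if $x$ is diagonalizable over $\mathbb{F}_q$, and non-split if the characteristic polynomial of $x$ is irreducible over $\mathbb{F}_q$. Let $t=|\bar x|$ be the order of $\bar x$ in $\mathrm{PSL}_2(q)$. If $x$ is split, $\bar x$ is of $q$-good order if $t$ is odd and $t\mid q-1$, or $t$ is even and $4t\mid q-1$. If $x$ is non-split, $\bar x$ is of $q$-good order if $t$ is odd and $t\mid q+1$, or $t$ is even and $4t\mid q+1$. $\bar x$ is of $q$-bad order if it is not of $q$-good order. *)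

(* Defs.v *)
From mathcomp Require Import all_boot all_order all_fingroup all_algebra.
From mathcomp Require Import all_solvable all_field.

Set Implicit Arguments.
Unset Strict Implicit.
Unset Printing Implicit Defensive.

Import GRing.Theory.
Local Open Scope ring_scope.

Section SL2.

Variable F : finFieldType.

Definition SL2 : {set {'GL_2[F]}} := [set x | \det (GLval x) == 1].

Definition pmI : {set {'GL_2[F]}} :=
  [set x | (GLval x == 1%:M) || (GLval x == (-1)%:M)].

Lemma SL2_group_set : group_set SL2.
Proof.
apply/group_setP; split=> [|x y]; first by rewrite inE GL_1E det1.
by rewrite !inE GL_ME det_mulmx => /eqP-> /eqP->; rewrite mul1r.
Qed.
Canonical SL2_group := Group SL2_group_set.

Lemma pmI_group_set : group_set pmI.
Proof.
apply/group_setP; split=> [|x y]; first by rewrite inE GL_1E eqxx.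
rewrite !inE GL_MxE => /orP[] /eqP-> /orP[] /eqP->;
by rewrite -scalar_mxM ?mulr1 ?mul1r ?mulrNN ?mulr1 eqxx ?orbT.
Qed.
Canonical pmI_group := Group pmI_group_set.

(* The type [coset_of pmI] carries all of GL_2(F) / {I, -I}; PSL_2(F) is a
   subgroup of it, in which membership has to be required explicitly. *)
Definition PSL2 : {set coset_of pmI} := (SL2 / pmI)%g.

Implicit Types (x : {'GL_2[F]}) (g : coset_of pmI).

(* Semisimple means diagonalizable over an algebraic closure; for a single
   matrix this amounts to diagonalizable over some finite extension of F. *)
Definition semisimple x : Prop :=
  exists L : fieldExtType F, diagonalizable (map_mx (in_alg L) (GLval x)).

Definition unipotent x : Prop := exists n : nat, (GLval x - 1) ^+ n = 0.

Definition is_split x : Prop := diagonalizable (GLval x).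

Definition is_nonsplit x : Prop := irreducible_poly (char_poly (GLval x)).

Definition psl_semisimple g : Prop :=
  exists x, [/\ x \in SL2, semisimple x & g = coset pmI x].

Definition psl_unipotent g : Prop :=
  exists x, [/\ x \in SL2, unipotent x & g = coset pmI x].

Definition noncentral_semisimple x : Prop :=
  [/\ x \in SL2, x \notin 'Z(SL2)%g, semisimple x & coset pmI x != 1%g].

Definition good_order_wrt (m t : nat) : bool :=
  ((odd t && (t %| m)) || (~~ odd t && (4 * t %| m)))%N.

(* Orders are taken in PSL_2(F), while the type of the element is read off
   from a lift x in SL_2(F). *)
Definition q_good_order (q : nat) x : Prop :=
  (is_split x /\ good_order_wrt (q - 1)%N #[coset pmI x]%g) \/
  (is_nonsplit x /\ good_order_wrt (q + 1)%N #[coset pmI x]%g).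

Definition q_bad_order (q : nat) x : Prop := ~ q_good_order q x.

End SL2.

(* Main.v *)
(* Let z in SL_2(q) have trace t.  Fricke's identity gives
   tr [x, u] = (tr x - tr (xu))^2 + 2 when u is unipotent; conversely,
   noncentral elements of SL_2(q) with the same trace are conjugate in GL_2(q),
   so the image of z is a commutator as required iff t - 2 or - t - 2 is a
   square.  On the other side, put D = t^2 - 4 = (t - 2)(t + 2), nonzero for a
   noncentral semisimple z, which is split iff D is a square.  From
   (z + 1)^2 = (t + 2) z and the Frobenius map, z^((q - 1)/2) in the split case,
   and z^((q + 1)/2) in the non-split case, is 1 or -1 according to whether
   t + 2 is a square.  As -1 is the only involution of SL_2(q), this power being
   1 says that the order is q-good whenever 4 divides q - 1, resp. q + 1;
   when q = 1 mod 4, non-split elements have odd order, hence q-good order. *)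
Require Import Defs.
From mathcomp Require Import all_boot all_order all_fingroup all_algebra.
From mathcomp Require Import all_solvable all_field.
From mathcomp Require Import ring zify.

Set Implicit Arguments.
Unset Strict Implicit.
Unset Printing Implicit Defensive.

Import GRing.Theory.
Local Open Scope ring_scope.

(** * Two-by-two matrices *)

Section Matrix2.

Variable R : comNzRingType.
Implicit Types A B : 'M[R]_2.

Definition mx2 (a b c d : R) : 'M[R]_2 :=
  \matrix_(i, j) if i == 0 then if j == 0 then a else b
                 else if j == 0 then c else d.

Lemma mx2P A B :
    A 0 0 = B 0 0 -> A 0 1 = B 0 1 -> A 1 0 = B 1 0 -> A 1 1 = B 1 1 ->
  A = B.
Proof.
have ord2 (i : 'I_2) : i = 0 \/ i = 1.
  by case: i => [[|[|]]] // ilt; [left | right]; apply: val_inj.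
move=> e00 e01 e10 e11; apply/matrixP => i j.
by case: (ord2 i) => ->; case: (ord2 j) => ->.
Qed.

Lemma mulmx2E A B i j : (A *m B) i j = A i 0 * B 0 j + A i 1 * B 1 j.
Proof.
rewrite mxE !big_ord_recl big_ord0 addr0.
by congr (A i _ * B _ j + A i _ * B _ j); apply: val_inj.
Qed.

Lemma mxtrace2E A : \tr A = A 0 0 + A 1 1.
Proof.
rewrite /mxtrace !big_ord_recl big_ord0 addr0.
by congr (A _ _ + A _ _); apply: val_inj.
Qed.

Lemma det2E A : \det A = A 0 0 * A 1 1 - A 0 1 * A 1 0.
Proof.
rewrite (expand_det_row _ 0) !big_ord_recl big_ord0 addr0 /cofactor !det_mx11.
rewrite !mxE /= expr0 expr1 mul1r mulN1r mulrN.
by congr (A _ _ * A _ _ - A _ _ * A _ _); apply: val_inj.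
Qed.

Lemma mx2_sqr A : A *m A = \tr A *: A - (\det A)%:M.
Proof.
by apply: mx2P; rewrite mulmx2E !mxE mxtrace2E det2E /=; ring.
Qed.

(** Cayley-Hamilton with the square completed. The base on the left squares to the discriminant, so
    its powers are easy to compute. *)
Lemma mx2_completed_square A :
  (2%:R *: A + (- \tr A)%:M) ^+ 2 = (\tr A ^+ 2 - 4%:R * \det A)%:M.
Proof.
rewrite expr2 -mulmxE.
by apply: mx2P; rewrite mulmx2E !mxE mxtrace2E det2E /=; ring.
Qed.

(** In determinant 1 the scalar term vanishes, which ties powers of [A] to powers of the scalar
    [\tr A + 2]. *)
Lemma mx2_sqr_add1 A :
  (A + 1%:M) ^+ 2 = (\tr A + 2%:R) *: A + (1 - \det A)%:M.
Proof.
rewrite expr2 -mulmxE.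
by apply: mx2P; rewrite mulmx2E !mxE mxtrace2E det2E /=; ring.
Qed.

(** The second factor is the adjugate of [A + 1%:M], so the product is the determinant of
    [A + 1%:M]. *)
Lemma mx2_adj_add1 A :
  (A + 1%:M) * ((\tr A + 1)%:M - A) = (\tr A + 1 + \det A)%:M.
Proof.
rewrite -mulmxE.
by apply: mx2P; rewrite mulmx2E !mxE mxtrace2E det2E /=; ring.
Qed.

End Matrix2.

Lemma char_poly2E (R : comNzRingType) (A : 'M[R]_2) :
  char_poly A = 'X^2 - (\tr A)%:P * 'X + (\det A)%:P.
Proof.
rewrite [LHS]det2E mxtrace2E det2E !mxE /=.
rewrite !polyCD !polyCN !polyCM; ring.
Qed.

(** * Squares and half powers over a finite field of odd order *)

Section FiniteField.

Variable F : finFieldType.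
Hypothesis oddF : odd #|F|.

Definition is_square (a : F) : bool := [exists e : F, e ^+ 2 == a].

Lemma is_squareP a : reflect (exists e, e ^+ 2 = a) (is_square a).
Proof.
by apply: (iffP existsP) => -[e] => [/eqP|/eqP]; exists e.
Qed.

Lemma pchar_pnat_card : [pchar F].-nat #|F|.
Proof.
have [p p_pr pcharFp] := finPcharP F.
rewrite (eq_pnat _ (pcharf_eq pcharFp)) -cardsT.
exact: abelem_pgroup (fin_ring_pchar_abelem pcharFp).
Qed.

Lemma two_neq0 : 2%:R != 0 :> F.
Proof.
apply/negP => char2.
have pchar2 : 2%N \in [pchar F] by rewrite inE.
have := pchar_pnat_card.
rewrite (eq_pnat _ (pcharf_eq pchar2)) => /p_natP[k cF].
by move: oddF (card_finNzRing_gt1 F); rewrite cF oddX orbF => /eqP ->.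
Qed.

Lemma card_half : #|F| = (#|F|./2).*2.+1.
Proof. by rewrite -[LHS]odd_double_half oddF. Qed.

Lemma expf_half_sqr (a : F) : a != 0 -> (a ^+ #|F|./2) ^+ 2 = 1.
Proof.
move=> a0; apply: (mulfI a0); rewrite mulr1 -exprM muln2 -exprS -card_half.
exact: expf_card.
Qed.

Lemma opp1_neq1 : -1 != 1 :> F.
Proof. by rewrite -subr_eq0 -opprD oppr_eq0 two_neq0. Qed.

(** Euler's criterion. The converse writes [a] as a power of a generator of the cyclic group of
    units and shows that the exponent is even. *)
Lemma is_squareE (a : F) : a != 0 -> is_square a = (a ^+ #|F|./2 == 1).
Proof.
move=> a0; apply/is_squareP/eqP => [[e ea] | ].
  have e0 : e != 0 by apply: contraNneq a0 => e0; rewrite -ea e0 expr0n.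
  by rewrite -ea exprAC expf_half_sqr.
have [z z_prim] : exists z : F, (#|F|.-1).-primitive_root z.
  have qgt1 := card_finNzRing_gt1 F.
  have /hasP[z _ z_prim] :
      has (#|F|.-1).-primitive_root (enum (predC1 (0 : F))).
    apply: has_prim_root; first by rewrite ltn_predRL.
    - apply/allP => x; rewrite mem_enum inE unity_rootE => x0.
      apply/eqP; apply: (mulfI x0); rewrite mulr1 -exprS prednK ?expf_card //.
      exact: ltnW.
    - exact: enum_uniq.
    - by rewrite -cardE cardC1.
  by exists z.
move=> ah; have [i ai] : exists i : nat, a = z ^+ i.
  have [|i ai] := prim_rootP z_prim (x := a); last by exists i.
  by rewrite card_half -muln2 exprM ah expr1n.
(* Since [#|F|.-1] is twice [#|F|./2], cancelling the positive half leaves 2 dividing [i]. *)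
have : (#|F|.-1 %| i * #|F|./2)%N.
  by rewrite (prim_order_dvd z_prim) exprM -ai ah.
rewrite {1}card_half /= -muln2 mulnC dvdn_pmul2r; last first.
  by move: (card_finNzRing_gt1 F); rewrite [#|_|]card_half; case: _./2.
by move=> /dvdnP[j ij]; exists (z ^+ j); rewrite ai ij exprM.
Qed.

Lemma expf_half (a : F) : a != 0 ->
  a ^+ #|F|./2 = if is_square a then 1 else -1.
Proof.
move=> a0; rewrite is_squareE //; case: eqP => // a1.
by have /eqP := expf_half_sqr a0; rewrite sqrf_eq1 => /orP[]/eqP.
Qed.

Lemma is_squareM (a b : F) : a != 0 -> b != 0 ->
  is_square (a * b) = (is_square a == is_square b).
Proof.
move=> a0 b0; rewrite [LHS]is_squareE ?mulf_neq0 // exprMn !expf_half //.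
by do 2!case: ifP => _; rewrite ?mulrNN ?mulN1r ?mul1r ?eqxx ?(negPf opp1_neq1).
Qed.

Lemma is_squareN1 : is_square (-1 : F) = (#|F| %% 4 == 1)%N.
Proof.
rewrite is_squareE ?oppr_eq0 ?oner_eq0 // -signr_odd.
have := card_half; set k := #|F|./2 => ->.
case: (boolP (odd k)) => ok;
  rewrite /= ?expr1 ?expr0 ?eqxx ?(negPf opp1_neq1); lia.
Qed.

(** The Frobenius map is additive only in a commutative ring, so the computation is done in
    [{poly F}] and transported by [horner_mx A]. *)
Lemma mx_affine_card (A : 'M[F]_2) (a b : F) :
  (a *: A + b%:M) ^+ #|F| = a *: A ^+ #|F| + b%:M.
Proof.
have -> : a *: A + b%:M = horner_mx A (a *: 'X + b%:P).
  by rewrite rmorphD /= linearZ /= horner_mx_X horner_mx_C.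
have charP : [pchar {poly F}].-nat #|F|.
  by rewrite (eq_pnat _ (pchar_poly F)) pchar_pnat_card.
rewrite -rmorphXn exprDn_pchar // exprZn -polyC_exp !expf_card.
by rewrite rmorphD /= linearZ /= rmorphXn /= horner_mx_X horner_mx_C.
Qed.

(** * Frobenius and half powers of matrices of determinant 1 *)

Section Determinant1.

Variable A : 'M[F]_2.
Hypothesis detA : \det A = 1.
Local Notation tA := (\tr A).
Hypothesis disc0 : tA ^+ 2 - 4%:R != 0.

(** Frobenius fixes the two eigenvalues or swaps them. Concretely, [w ^+ 2 = D%:M] gives [w ^+ #|F|]
    as [w] times the quadratic character of [D], and the Frobenius map gives the same power in terms
    of [A ^+ #|F|]. *)
Lemma sl2_expr_card :
  A ^+ #|F| = if is_square (tA ^+ 2 - 4%:R) then A else tA%:M - A.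
Proof.
set D := tA ^+ 2 - 4%:R; set w := 2%:R *: A + (- tA)%:M.
have w2 : w ^+ 2 = D%:M by rewrite mx2_completed_square detA mulr1.
have wq : w ^+ #|F| = D ^+ #|F|./2 *: w.
  rewrite {1}card_half exprSr -mul2n exprM w2 -rmorphXn /=.
  by rewrite -mulmxE mul_scalar_mx.
move: wq; rewrite mx_affine_card expf_half // => wq.
apply: (scalerI two_neq0); apply: (addIr (- tA)%:M); rewrite wq.
case: ifP => _; first by rewrite scale1r.
by apply: mx2P; rewrite !mxE /=; ring.
Qed.

Let s0 : tA + 2%:R != 0.
Proof.
apply: contraNneq disc0 => s0.
have -> : tA ^+ 2 - 4%:R = (tA + 2%:R) * (tA - 2%:R) by ring.
by rewrite s0 mul0r.
Qed.

Let sl2_sqr_add1 : (A + 1%:M) ^+ 2 = (tA + 2%:R) *: A.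
Proof. by rewrite mx2_sqr_add1 detA subrr raddf0 addr0. Qed.

Let cancel_sign (b : bool) (X : 'M[F]_2) :
    (tA + 2%:R) *: ((if b then 1 else -1) *: X) = (tA + 2%:R)%:M ->
  X = (if b then 1 else -1)%:M.
Proof.
rewrite -[X in _ = X]scalemx1 => /(scalerI s0).
by case: b; rewrite ?scale1r // scaleN1r => X1; rewrite raddfN /= -X1 opprK.
Qed.

(** Here [A + 1%:M] is fixed by Frobenius. Its power is also computed by repeated use of its square,
    and multiplying by its adjugate turns the leftover factor [A + 1%:M] into the nonzero scalar
    [tA + 2]. *)
Lemma sl2_half_expr_split : is_square (tA ^+ 2 - 4%:R) ->
  A ^+ #|F|./2 = (if is_square (tA + 2%:R) then 1 else -1)%:M.
Proof.
move=> sqD; have Aq : (A + 1%:M) ^+ #|F| = A + 1%:M.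
  by rewrite -{1}[A]scale1r mx_affine_card sl2_expr_card sqD scale1r.
move: Aq; rewrite {1}card_half exprSr -mul2n exprM sl2_sqr_add1.
rewrite exprZn expf_half // => /(congr1 ( *%R^~ ((tA + 1)%:M - A))).
rewrite -mulrA mx2_adj_add1 detA -addrA -mulmxE mul_mx_scalar.
exact: cancel_sign.
Qed.

(** Here Frobenius sends [A + 1%:M] to its adjugate, so its power of exponent [#|F|.+1] is its
    determinant [tA + 2]. The same power is computed from its square. *)
Lemma sl2_half_expr_nonsplit : ~~ is_square (tA ^+ 2 - 4%:R) ->
  A ^+ #|F|./2.+1 = (if is_square (tA + 2%:R) then 1 else -1)%:M.
Proof.
move=> sqD; have Aq : (A + 1%:M) ^+ #|F|.+1 = (tA + 2%:R)%:M.
  rewrite exprS -{2}[A]scale1r mx_affine_card sl2_expr_card (negPf sqD) scale1r.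
  by rewrite addrAC -raddfD mx2_adj_add1 detA -addrA.
move: Aq; rewrite {1}card_half -doubleS -mul2n exprM sl2_sqr_add1.
rewrite exprZn exprS expf_half // -scalerA.
exact: cancel_sign.
Qed.

End Determinant1.

End FiniteField.

(** * Split and non-split elements *)

Section Diagonalizable2.

Variable K : fieldType.
Implicit Types A : 'M[K]_2.

Lemma root_char_poly2 A r :
  root (char_poly A) r = (r ^+ 2 - \tr A * r + \det A == 0).
Proof. by rewrite /root char_poly2E !hornerE. Qed.

(** The other eigenvalue is [\tr A - r], and a nonzero discriminant keeps the two apart, so the
    minimal polynomial divides a product of distinct linear factors. *)
Lemma root_diagonalizable A r :
  root (char_poly A) r -> \tr A ^+ 2 - 4%:R * \det A != 0 -> diagonalizable A.
Proof.
rewrite root_char_poly2 => /eqP rA disc0; apply/diagonalizableP.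
have detA : \det A = r * (\tr A - r).
  by apply/eqP; rewrite -subr_eq0 -rA; apply/eqP; ring.
exists [:: r; \tr A - r].
  rewrite /= inE andbT; apply: contraNneq disc0; rewrite detA => rr.
  have -> : \tr A ^+ 2 - 4%:R * (r * (\tr A - r)) = (r - (\tr A - r)) ^+ 2.
    by ring.
  by rewrite {1}rr subrr expr0n.
rewrite !big_cons big_nil mulr1.
suff <- : char_poly A = ('X - r%:P) * ('X - (\tr A - r)%:P).
  exact: mxminpoly_dvd_char.
by rewrite char_poly2E detA polyCM polyCB; ring.
Qed.

Lemma diagonalizable_mxminpoly A : diagonalizable A ->
  exists2 rs, uniq rs & mxminpoly A = \prod_(r <- rs) ('X - r%:P).
Proof.
move=> [P Punit /(similar_diag_mxminpoly Punit) Am].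
by eexists; last exact: Am; exact: undup_uniq.
Qed.

Lemma mxminpoly_neq1 A : mxminpoly A != 1.
Proof.
apply/eqP => Am; have := mx_root_minpoly A.
by rewrite Am rmorph1 => /eqP; rewrite oner_eq0.
Qed.

Lemma diagonalizable_root A : diagonalizable A ->
  exists r, root (char_poly A) r.
Proof.
move=> /diagonalizable_mxminpoly[[|r rs] _ Am].
  by have := mxminpoly_neq1 A; rewrite Am big_nil eqxx.
by exists r; rewrite -root_mxminpoly Am root_prod_XsubC mem_head.
Qed.

(** The minimal polynomial is a product of distinct linear factors with [c] as only possible root,
    so it is ['X - c%:P]. *)
Lemma diagonalizable_double_root A c : diagonalizable A ->
  \tr A = c + c -> \det A = c ^+ 2 -> A = c%:M.
Proof.
move=> /diagonalizable_mxminpoly[rs rs_uniq Am] trA detA.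
have rsE r : r \in rs -> r = c.
  rewrite -root_prod_XsubC -Am root_mxminpoly root_char_poly2 trA detA.
  have -> : r ^+ 2 - (c + c) * r + c ^+ 2 = (r - c) ^+ 2 by ring.
  by rewrite expf_eq0 subr_eq0 => /eqP.
have := mx_root_minpoly A; rewrite Am.
case: rs => [|r [|r' rs]] in rs_uniq Am rsE *.
- by have := mxminpoly_neq1 A; rewrite Am big_nil eqxx.
- rewrite big_seq1 (rsE r) ?mem_head // rmorphB /= horner_mx_X horner_mx_C.
  by move/eqP; rewrite subr_eq0 => /eqP.
- have rc : r = c by apply: rsE; rewrite inE eqxx.
  have r'c : r' = c by apply: rsE; rewrite !inE eqxx orbT.
  by move: rs_uniq; rewrite rc r'c /= inE eqxx.
Qed.

End Diagonalizable2.

Section SplitType.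

Variable F : finFieldType.
Hypothesis oddF : odd #|F|.
Variable x : {'GL_2[F]}.
Hypothesis detx : \det (GLval x) = 1.
Local Notation disc := (\tr (GLval x) ^+ 2 - 4%:R).

Lemma square_disc_root :
  reflect (exists r, root (char_poly (GLval x)) r) (is_square disc).
Proof.
apply: (iffP (is_squareP _)) => [[e eD] | [r]]; last first.
  (* The quadratic formula solved for the square root of the discriminant. *)
  rewrite root_char_poly2 detx => /eqP xr; exists (2%:R * r - \tr (GLval x)).
  by apply/eqP; rewrite -subr_eq0 -[0](mulr0 4%:R) -xr; apply/eqP; ring.
exists ((\tr (GLval x) + e) / 2%:R).
have four0 : 4%:R != 0 :> F by rewrite (natrM _ 2 2) mulf_neq0 ?two_neq0.
rewrite root_char_poly2 detx; set t := \tr _ in eD *.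
have -> : ((t + e) / 2%:R) ^+ 2 - t * ((t + e) / 2%:R) + 1
    = (e ^+ 2 - (t ^+ 2 - 4%:R)) / 4%:R by field; rewrite four0 two_neq0.
by rewrite eD subrr mul0r.
Qed.

Lemma is_split_square : is_split x -> is_square disc.
Proof. by move=> /diagonalizable_root xr; apply/square_disc_root. Qed.

Lemma square_is_split : disc != 0 -> is_square disc -> is_split x.
Proof.
move=> disc0 /square_disc_root[r xr]; apply: root_diagonalizable xr _.
by rewrite detx mulr1.
Qed.

Lemma is_nonsplitE : is_nonsplit x <-> ~~ is_square disc.
Proof.
split=> [[_ xirr]|xsq].
  apply/negP => /square_disc_root[r]; rewrite root_factor_theorem => /xirr.
  rewrite size_XsubC => /(_ isT) /eqp_size.
  by rewrite size_XsubC size_char_poly.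
apply: cubic_irreducible => [|r]; first by rewrite size_char_poly.
by apply: contra xsq => xr; apply/square_disc_root; exists r.
Qed.

Lemma disc_semisimple : disc != 0 -> semisimple x.
Proof.
move=> disc0; have px0 : char_poly (GLval x) != 0.
  exact: monic_neq0 (char_poly_monic _).
(* Over a splitting field of the characteristic polynomial there is a root, and the discriminant
   stays nonzero. *)
have [L [rs xrs _]] := FinSplittingFieldFor px0; exists L.
have /eqp_size := xrs.
rewrite size_map_poly size_char_poly size_prod_XsubC => -[].
case: rs xrs => // r rs xrs _; apply: (@root_diagonalizable _ _ r).
  by rewrite -map_char_poly (eqp_root xrs) root_prod_XsubC mem_head.
rewrite det_map_mx trace_map_mx detx rmorph1 mulr1.
by rewrite -rmorphXn -(rmorph_nat (in_alg L) 4) -rmorphB fmorph_eq0.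
Qed.

(** The trace is 2 or -2, so 1 or -1 is a double eigenvalue. Over [L] the matrix is then scalar, and
    this descends to [F] by injectivity of [map_mx]. *)
Lemma semisimple_disc0 : semisimple x -> disc = 0 -> x \in pmI F.
Proof.
move=> [L xdiag] disc0.
have : (\tr (GLval x) - 2%:R) * (\tr (GLval x) + 2%:R) = 0.
  by rewrite -disc0; ring.
move=> /eqP; rewrite mulf_eq0 subr_eq0 addr_eq0 inE => xtr.
suff xc (c : F) : c ^+ 2 = 1 -> \tr (GLval x) = c + c -> GLval x = c%:M.
  case/orP: xtr => /eqP xtr; apply/orP; [left | right]; apply/eqP; apply: xc.
  - by rewrite expr1n.
  - exact: xtr.
  - by rewrite sqrrN expr1n.
  - by rewrite xtr; ring.
move=> c2 xtr_c; apply: (@map_mx_inj _ _ (in_alg L)).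
rewrite map_scalar_mx; apply: diagonalizable_double_root xdiag _ _.
  by rewrite trace_map_mx xtr_c rmorphD.
by rewrite det_map_mx detx -c2 rmorphXn.
Qed.

End SplitType.

(** * Orders modulo [pmI] *)

Lemma cosetM_norm (gT : finGroupType) (H : {set gT}) (x y : gT) :
    x \in 'N(H)%g -> y \in 'N(H)%g ->
  coset H (x * y)%g = (coset H x * coset H y)%g.
Proof. exact: morphM. Qed.

Section Group.

Variable F : finFieldType.
Implicit Types x y z u p : {'GL_2[F]}.

Lemma GL_lift (M : 'M[F]_2) : \det M != 0 -> exists x, GLval x = M.
Proof.
rewrite -unitfE -unitmxE => Mu.
by exists (Sub M Mu); rewrite SubK.
Qed.

Lemma GL_inj x y : GLval x = GLval y -> x = y.
Proof. exact: val_inj. Qed.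

Lemma GL_XE x n : GLval (x ^+ n)%g = GLval x ^+ n.
Proof. by elim: n => // n IHn; rewrite expgS exprS GL_ME IHn. Qed.

Lemma SL2_det x : (x \in SL2 F) = (\det (GLval x) == 1).
Proof. by rewrite inE. Qed.

Lemma SL2_X x n : x \in SL2 F -> (x ^+ n)%g \in SL2 F.
Proof.
rewrite !SL2_det GL_XE => /eqP detx.
by elim: n => [|n IHn]; rewrite ?det1 // exprS -mulmxE det_mulmx detx mul1r.
Qed.

Lemma SL2_VE x : x \in SL2 F -> GLval x^-1%g = (\tr (GLval x))%:M - GLval x.
Proof.
rewrite SL2_det => /eqP detx; rewrite GL_VE.
apply: (mulrI (GL_unit x)); rewrite mulrV ?GL_unit // mulrBr.
by rewrite -!mulmxE mx2_sqr detx mul_mx_scalar subKr.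
Qed.

Lemma mxtrace_conjg x p : \tr (GLval (x ^ p)%g) = \tr (GLval x).
Proof. by rewrite conjgE GL_MxE mxtrace_mulC -GL_MxE mulgK. Qed.

Lemma SL2_conjg x p : x \in SL2 F -> (x ^ p)%g \in SL2 F.
Proof.
rewrite !SL2_det => /eqP detx.
by rewrite conjgE GL_MxE det_mulmx mulrC -det_mulmx -GL_MxE mulgK detx.
Qed.

Lemma pmI_commute x y : y \in pmI F -> commute x y.
Proof.
rewrite inE => yI; apply: GL_inj; rewrite !GL_MxE.
by case/orP: yI => /eqP ->; rewrite scalar_mxC.
Qed.

(** By centrality of the signs, [coset (pmI F)] is multiplicative on all of GL_2 without side
    conditions. *)
Lemma norm_pmI x : x \in 'N(pmI F)%g.
Proof.
rewrite inE; apply/subsetP => _ /imsetP[y yI ->].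
by rewrite conjgE -(pmI_commute x yI) mulKg.
Qed.

Lemma coset_pmI1 : coset (pmI F) 1%g = 1%g.
Proof. by apply: coset_id; rewrite inE GL_1E eqxx. Qed.

Lemma coset_pmIM x y :
  coset (pmI F) (x * y)%g = (coset (pmI F) x * coset (pmI F) y)%g.
Proof. exact: cosetM_norm (norm_pmI x) (norm_pmI y). Qed.

Lemma coset_pmIV x : coset (pmI F) x^-1%g = ((coset (pmI F) x)^-1)%g.
Proof.
by apply: (mulgI (coset (pmI F) x)); rewrite -coset_pmIM !mulgV coset_pmI1.
Qed.

Lemma coset_pmIX x n : coset (pmI F) (x ^+ n)%g = (coset (pmI F) x ^+ n)%g.
Proof.
by elim: n => [|n IHn]; rewrite ?coset_pmI1 // !expgS coset_pmIM IHn.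
Qed.

Lemma coset_pmI_eq1 x : (coset (pmI F) x == 1%g) = (x \in pmI F).
Proof.
apply/eqP/idP => [x1 | ]; first exact: coset_idr (norm_pmI x) x1.
exact: coset_id.
Qed.

Lemma coset_pmI_eq x y :
  coset (pmI F) x = coset (pmI F) y <->
  GLval x = GLval y \/ GLval x = - GLval y.
Proof.
split=> [xy | xy].
  have : (x * y^-1)%g \in pmI F.
    by rewrite -coset_pmI_eq1 coset_pmIM coset_pmIV xy mulgV.
  rewrite inE => /orP[]/eqP xyE; [left | right].
    by rewrite -[x](mulgKV y) GL_MxE xyE mul1mx.
  by rewrite -[x](mulgKV y) GL_MxE xyE mul_scalar_mx scaleN1r.
rewrite -[x](mulgKV y) coset_kerl // inE GL_ME GL_VE.
case: xy => ->; first by rewrite mulrV ?GL_unit // eqxx.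
by rewrite mulNr mulrV ?GL_unit // raddfN eqxx orbT.
Qed.

Lemma order_coset_dvd x n :
  (#[coset (pmI F) x]%g %| n)%N = (x ^+ n \in pmI F)%g.
Proof.
by rewrite order_dvdn -coset_pmIX coset_pmI_eq1.
Qed.

Lemma pmI_sqr x : x \in pmI F -> (x ^+ 2 = 1)%g.
Proof.
rewrite inE => xI; apply: GL_inj; rewrite GL_XE.
by case/orP: xI => /eqP->; rewrite -rmorphXn /= ?sqrrN expr1n.
Qed.

Hypothesis oddF : odd #|F|.

(** Cayley-Hamilton gives [\tr x *: x = 2]. As 2 is nonzero so is the trace, hence [x] is a scalar
    whose square is its determinant 1. *)
Lemma SL2_sqr1 x : x \in SL2 F -> (x ^+ 2 = 1)%g -> x \in pmI F.
Proof.
rewrite SL2_det inE => /eqP detx /(congr1 (@GLval _ _)).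
rewrite GL_XE expr2 -mulmxE mx2_sqr detx => /eqP; rewrite subr_eq => /eqP.
rewrite GL_1E -mulr2n => x2.
have t0 : \tr (GLval x) != 0.
  apply: contraNneq (two_neq0 oddF) => t0; move: x2; rewrite t0 scale0r.
  by move/matrixP/(_ 0 0); rewrite !mxE /= => ->.
have {x2} xE : GLval x = (2%:R / \tr (GLval x))%:M.
  apply: (scalerI t0); rewrite x2 scale_scalar_mx mulrC divfK //.
  by rewrite raddfMn.
move: detx; rewrite xE det_scalar => /eqP; rewrite sqrf_eq1.
by case/orP => /eqP ->; rewrite eqxx ?orbT.
Qed.

(** Write m = 4j and let t be the order in the quotient. Then t divides 2j and x^(2t) = 1. For odd t
    both sides hold. For even t both amount to t dividing j, because x^t = 1 would make x^(t/2) a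
    square root of 1, hence central. *)
Lemma good_order_half x m : x \in SL2 F -> (4 %| m)%N -> (x ^+ m = 1)%g ->
  good_order_wrt m #[coset (pmI F) x]%g = (x ^+ m./2 == 1)%g.
Proof.
move=> xS /dvdnP[j ->]; rewrite (mulnA j 2 2) muln2 doubleK => xm.
have xh : (x ^+ (j * 2) \in pmI F)%g.
  by apply: SL2_sqr1; [exact: SL2_X | rewrite -expgM muln2].
have t0 := order_gt0 (coset (pmI F) x).
have := order_coset_dvd x; move: xh.
set t := #[_]%g in t0 * => xh tE; rewrite -tE in xh.
have xt2 : (x ^+ (t * 2) = 1)%g by rewrite expgM pmI_sqr // -tE.
have [k jk] := dvdnP xh.
rewrite /good_order_wrt; apply/idP/eqP => [good | xj].
  suff /dvdnP[l ->] : (t * 2 %| j * 2)%N by rewrite mulnC expgM xt2 expg1n.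
  case/orP: good => /andP[todd tj]; last first.
    by move: tj; rewrite -muln2 -mulnA mulnC !dvdn_pmul2r.
  by rewrite Gauss_dvd ?coprimen2 // xh dvdn_mull.
case: (boolP (odd t)) => /= [_ | t_even].
  by rewrite orbF -muln2 dvdn_mulr.
suff k2 : (2 %| k)%N.
  by rewrite jk; case/dvdnP: k2 => l ->; apply/dvdnP; exists l; lia.
(* For odd [k], the exponent [k * t] is [t] modulo [t * 2], so [x ^+ t = 1]. Then [t./2] already
   kills the coset, against the minimality of [t]. *)
rewrite dvdn2; apply/negP => k_odd.
have xt : (x ^+ t = 1)%g.
  move: xj; rewrite jk -[k]odd_double_half k_odd mulnDl mul1n expgD -muln2.
  by rewrite -mulnA mulnC [(2 * t)%N]mulnC expgM xt2 expg1n mulg1.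
have : (t %| t./2)%N.
  rewrite tE; apply: SL2_sqr1; first exact: SL2_X.
  by rewrite -expgM muln2 even_halfK.
by move/dvdn_leq; lia.
Qed.

End Group.

(** * Commutators *)

(* Fricke's trace identity, with adj X = (tr X)%:M - X in place of inverses. *)
Lemma mxtrace_commutator2 (R : comNzRingType) (X U : 'M[R]_2) :
  \tr (X *m U *m ((\tr X)%:M - X) *m ((\tr U)%:M - U)) =
    \tr X ^+ 2 * \det U + \tr U ^+ 2 * \det X + \tr (X *m U) ^+ 2
    - \tr X * \tr U * \tr (X *m U) - 2%:R * \det X * \det U.
Proof.
rewrite !mxtrace2E !det2E !(mulmx2E, mxE) /=; ring.
Qed.

(** A nonscalar matrix has a cyclic row vector, and one of (1, 0), (0, 1), (1, 1) always serves. *)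
Lemma mx2_companion (K : fieldType) (A : 'M[K]_2) :
    (forall c, A <> c%:M) ->
  exists2 P : 'M_2, \det P != 0 & P *m A = mx2 0 1 (- \det A) (\tr A) *m P.
Proof.
move=> A_nonscalar.
(* The rows are (v, w) and its image under [A]. The determinant is a quadratic form in v and w that
   vanishes at all three candidates only for scalar [A]. *)
pose P v w := mx2 v w (v * A 0 0 + w * A 1 0) (v * A 0 1 + w * A 1 1).
have PA v w : P v w *m A = mx2 0 1 (- \det A) (\tr A) *m P v w.
  by apply: mx2P; rewrite !mulmx2E !mxE /= ?mxtrace2E ?det2E; ring.
have detP v w : \det (P v w) =
    v ^+ 2 * A 0 1 + v * w * (A 1 1 - A 0 0) - w ^+ 2 * A 1 0.
  by rewrite det2E !mxE /=; ring.
have [b0|b0] := eqVneq (A 0 1) 0; last first.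
  exists (P 1 0); rewrite // detP !(expr0n, mul0r, mulr0) expr1n mul1r.
  by rewrite !subr0 addr0.
have [c0|c0] := eqVneq (A 1 0) 0; last first.
  exists (P 0 1); rewrite // detP !(expr0n, mul0r, expr1n, mul1r, add0r).
  by rewrite oppr_eq0.
have [d0|d0] := eqVneq (A 1 1) (A 0 0).
  case: (A_nonscalar (A 0 0)).
  by apply: mx2P; rewrite !mxE /= ?mulr1n ?mulr0n.
exists (P 1 1); rewrite // detP b0 c0 !(expr1n, mul1r, add0r, subr0).
by rewrite subr_eq0.
Qed.

Section Commutator.

Variable F : finFieldType.
Implicit Types x y z u p : {'GL_2[F]}.
Hypothesis oddF : odd #|F|.

(** Both are conjugate to the companion matrix of their common characteristic polynomial. The
    conjugator lies in GL_2 only, which suffices because traces and determinants are all that is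
    used later. *)
Lemma SL2_conj z w : z \in SL2 F -> w \in SL2 F ->
    (forall c, GLval z <> c%:M) -> (forall c, GLval w <> c%:M) ->
    \tr (GLval z) = \tr (GLval w) ->
  exists p, z = (w ^ p)%g.
Proof.
rewrite !SL2_det => /eqP detz /eqP detw z_ns w_ns tzw.
have [P Pdet zP] := mx2_companion z_ns; have [Q Qdet wQ] := mx2_companion w_ns.
have [p pP] := GL_lift Pdet; have [q qQ] := GL_lift Qdet.
rewrite detz tzw -pP in zP; rewrite detw -qQ in wQ.
have [c cE] : exists c : {'GL_2[F]}, GLval c = mx2 0 1 (- 1) (\tr (GLval w)).
  by apply: GL_lift; rewrite det2E !mxE /= mul0r sub0r mulrN1 opprK oner_eq0.
have pz : (p * z = c * p)%g by apply: GL_inj; rewrite !GL_MxE cE.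
have qw : (q * w = c * q)%g by apply: GL_inj; rewrite !GL_MxE cE.
have wE : (w = q^-1 * (c * q))%g by rewrite -qw mulKg.
exists (q^-1 * p)%g; rewrite conjgE invMg invgK wE !mulgA !mulgK.
by rewrite -mulgA -pz mulKg.
Qed.

Lemma unipotent_det x : unipotent x -> \det (GLval x - 1) = 0.
Proof.
move=> [n /(congr1 determinant)]; rewrite det0 // => xn0.
suff detX (A : 'M[F]_2) : \det (A ^+ n) = \det A ^+ n.
  by move/eqP: xn0; rewrite detX expf_eq0 => /andP[_ /eqP].
by elim: n {xn0} => [|n IHn]; rewrite ?det1 // !exprS -mulmxE det_mulmx IHn.
Qed.

(** In SL_2 the determinant of x - 1 is 2 minus the trace. If it vanishes, x - 1 has trace and
    determinant 0 and squares to 0. *)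
Lemma unipotentE x : x \in SL2 F -> \tr (GLval x) = 2%:R <-> unipotent x.
Proof.
rewrite SL2_det => /eqP detx.
have det_sub1 (A : 'M[F]_2) : \det (A - 1) = \det A - \tr A + 1.
  by rewrite det2E mxtrace2E det2E !mxE /=; ring.
split=> [trx | /unipotent_det]; last first.
  rewrite det_sub1 detx => /eqP.
  by rewrite addrAC subr_eq0 => /eqP <-.
exists 2%N; rewrite expr2 -mulmxE mx2_sqr det_sub1 detx mxtraceD trx.
rewrite raddfN /= mxtrace1 subrr scale0r sub0r.
by rewrite addrAC subrr raddf0 oppr0.
Qed.

Lemma mxtrace_commutator x u : x \in SL2 F -> u \in SL2 F ->
    \tr (GLval u) = 2%:R ->
  \tr (GLval (x * u * x^-1 * u^-1)%g)
    = (\tr (GLval x) - \tr (GLval x *m GLval u)) ^+ 2 + 2%:R.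
Proof.
move=> xS uS tru; rewrite !GL_MxE !SL2_VE // mxtrace_commutator2 tru.
by move: xS uS; rewrite !SL2_det => /eqP -> /eqP ->; ring.
Qed.

End Commutator.

(** * The trace criterion for commutators in the quotient *)

Section Criterion.

Variable F : finFieldType.
Hypothesis oddF : odd #|F|.
Implicit Types x y z u p : {'GL_2[F]}.

Definition psl_commutator (g : coset_of (pmI F)) : Prop :=
  exists s u : coset_of (pmI F),
    [/\ psl_semisimple s, psl_unipotent u & g = (s * u * s^-1 * u^-1)%g].

Lemma scalar_SL2_pmI x c : x \in SL2 F -> GLval x = c%:M -> x \in pmI F.
Proof.
rewrite SL2_det inE => /eqP detx xc; move: detx; rewrite xc det_scalar => /eqP.
by rewrite sqrf_eq1 => /orP[] /eqP ->; rewrite eqxx ?orbT.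
Qed.

Lemma coset_commutator x u :
  coset (pmI F) (x * u * x^-1 * u^-1)%g =
  (coset (pmI F) x * coset (pmI F) u * (coset (pmI F) x)^-1
    * (coset (pmI F) u)^-1)%g.
Proof. by rewrite !coset_pmIM !coset_pmIV. Qed.

(** For the elementary matrix [u], the trace of [x] minus that of [x u] is minus the lower left
    entry of [x], so this entry is chosen to be [e]. The commutator must be nonscalar for [SL2_conj]
    to apply. *)
Lemma explicit_commutator e : (3 < #|F|)%N ->
  exists x u, [/\ x \in SL2 F, u \in SL2 F,
    \tr (GLval x) ^+ 2 - 4%:R != 0, \tr (GLval u) = 2%:R
    & \tr (GLval (x * u * x^-1 * u^-1)%g) = e ^+ 2 + 2%:R /\
      forall c, GLval (x * u * x^-1 * u^-1)%g <> c%:M].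
Proof.
move=> F3.
have four0 : 4%:R != 0 :> F by rewrite (natrM _ 2 2) mulf_neq0 ?two_neq0.
have [u uE] : exists u : {'GL_2[F]}, GLval u = mx2 1 1 0 1.
  by apply: GL_lift; rewrite det2E !mxE /= mulr1 mulr0 subr0 oner_eq0.
have uS : u \in SL2 F.
  by rewrite SL2_det uE det2E !mxE /= mulr1 mulr0 subr0.
have tru : \tr (GLval u) = 2%:R by rewrite uE mxtrace2E !mxE.
have [e0|e0] := eqVneq e 0.
  (* For [e = 0] a diagonal [x] is used. It needs distinct eigenvalues [a] and [a^-1], and such an
     [a] exists because the field has more than three elements. *)
  have [a] : exists a : F, a \notin [:: 0; 1; -1].
    apply/existsP; rewrite -negb_forall; apply/negP => /forallP Fsub.
    have : (#|F| <= size [:: 0; 1; -1 : F]%R)%N.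
      apply: leq_trans (card_size _); apply/subset_leq_card/subsetP => a _.
      exact: Fsub.
    by rewrite leqNgt F3.
  rewrite !inE !negb_or => /and3P[a0 a1 a_1].
  have a2 : a ^+ 2 - 1 != 0 by rewrite subr_eq0 sqrf_eq1 negb_or a1.
  have [x xE] : exists x : {'GL_2[F]}, GLval x = mx2 a 0 0 a^-1.
    by apply: GL_lift; rewrite det2E !mxE /= divff // mul0r subr0 oner_eq0.
  have xS : x \in SL2 F.
    by rewrite SL2_det xE det2E !mxE /= divff // mul0r subr0.
  exists x, u; split=> //.
    rewrite xE mxtrace2E !mxE /=.
    have -> : (a + a^-1) ^+ 2 - 4%:R = ((a ^+ 2 - 1) / a) ^+ 2 by field.
    by rewrite expf_neq0 // mulf_neq0 ?invr_eq0.
  split=> [|c].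
    rewrite mxtrace_commutator // xE uE !mxtrace2E !mulmx2E !mxE /= e0.
    by ring.
  rewrite !GL_MxE !SL2_VE // xE uE !mxtrace2E => /matrixP/(_ 0 1).
  rewrite !mulmx2E !mxE /= => /eqP; apply/negP.
  rewrite (_ : _ + _ = a ^+ 2 - 1) ?mulr0n //; by field.
have [x xE] : exists x : {'GL_2[F]}, GLval x = mx2 0 (- e^-1) e 0.
  apply: GL_lift; rewrite det2E !mxE /= mul0r sub0r mulNr opprK mulVf //.
  by rewrite oner_eq0.
have xS : x \in SL2 F.
  by rewrite SL2_det xE det2E !mxE /= mul0r sub0r mulNr opprK mulVf.
exists x, u; split=> //.
  by rewrite xE mxtrace2E !mxE /= addr0 expr0n sub0r oppr_eq0.
split=> [|c].
  rewrite mxtrace_commutator // xE uE !mxtrace2E !mulmx2E !mxE /=.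
  by ring.
rewrite !GL_MxE !SL2_VE // xE uE !mxtrace2E => /matrixP/(_ 1 0).
rewrite !mulmx2E !mxE /= => /eqP; apply/negP.
rewrite (_ : _ + _ = - e ^+ 2) ?mulr0n ?oppr_eq0 ?expf_neq0 //; by field.
Qed.

Lemma commutator_psl x u : x \in SL2 F -> u \in SL2 F ->
    \tr (GLval x) ^+ 2 - 4%:R != 0 -> \tr (GLval u) = 2%:R ->
  psl_commutator (coset (pmI F) (x * u * x^-1 * u^-1)%g).
Proof.
move=> xS uS xdisc tru; exists (coset (pmI F) x), (coset (pmI F) u); split.
- exists x; split=> //; apply: disc_semisimple => //.
  by apply/eqP; rewrite -SL2_det.
- by exists u; split=> //; apply/unipotentE.
- exact: coset_commutator.
Qed.

Lemma square_commutator z : (3 < #|F|)%N -> z \in SL2 F ->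
  is_square (\tr (GLval z) - 2%:R) -> psl_commutator (coset (pmI F) z).
Proof.
move=> F3 zS /is_squareP[e ez].
have [x [u [xS uS xdisc tru [trxu xu_ns]]]] := explicit_commutator e F3.
have xuS : (x * u * x^-1 * u^-1)%g \in SL2 F.
  rewrite SL2_det !GL_ME !GL_VE -!mulmxE !det_mulmx !det_inv.
  by move: xS uS; rewrite !SL2_det => /eqP -> /eqP ->; rewrite !invr1 !mulr1.
(* A central [z] is not conjugate to the nonscalar commutator, but its image is trivial, so taking 1
   for the unipotent element is enough. *)
have [zI|z_nI] := boolP (z \in pmI F).
  have -> : coset (pmI F) z = coset (pmI F) (x * 1 * x^-1 * 1^-1)%g.
    rewrite mulg1 mulgV mul1g invg1 coset_pmI1.
    by apply/eqP; rewrite coset_pmI_eq1.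
  by apply: commutator_psl; rewrite // ?SL2_det GL_1E ?det1 ?mxtrace1.
have [p ->] : exists p, z = ((x * u * x^-1 * u^-1) ^ p)%g.
  apply: SL2_conj => // [c zc|].
    by case/negP: z_nI; apply: scalar_SL2_pmI zc.
  by rewrite trxu ez subrK.
rewrite !conjMg !conjVg.
by apply: commutator_psl; rewrite ?SL2_conjg ?mxtrace_conjg.
Qed.

(** The two disjuncts come from the two lifts [z] and [- z] of the same coset. *)
Lemma psl_commutatorP z : (3 < #|F|)%N -> z \in SL2 F ->
  psl_commutator (coset (pmI F) z) <->
  is_square (\tr (GLval z) - 2%:R) || is_square (- \tr (GLval z) - 2%:R).
Proof.
move=> F3 zS; split=> [[_ [_ [[x [xS _ ->]] [u [uS uU ->]]]]] | ].
  rewrite -coset_commutator => /coset_pmI_eq zE.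
  have sq : is_square (\tr (GLval (x * u * x^-1 * u^-1)%g) - 2%:R).
    rewrite mxtrace_commutator //; last by apply/unipotentE.
    by rewrite addrK; apply/is_squareP; eexists.
  by case: zE => ->; rewrite ?raddfN /= ?opprK sq ?orbT.
have [y yE] : exists y : {'GL_2[F]}, GLval y = - GLval z.
  apply: GL_lift; rewrite -scaleN1r detZ sqrrN expr1n mul1r.
  by move: zS; rewrite SL2_det => /eqP ->; rewrite oner_eq0.
have yS : y \in SL2 F.
  by rewrite SL2_det yE -scaleN1r detZ sqrrN expr1n mul1r -SL2_det.
case/orP => [|sq]; first exact: square_commutator.
have -> : coset (pmI F) z = coset (pmI F) y.
  by apply/coset_pmI_eq; right; rewrite yE opprK.
by apply: square_commutator; rewrite // yE raddfN.
Qed.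

End Criterion.

(** * Good orders and commutators *)

Section Orders.

Variable F : finFieldType.
Hypothesis oddF : odd #|F|.
Variable x : {'GL_2[F]}.
Hypothesis xS : x \in SL2 F.
Local Notation disc := (\tr (GLval x) ^+ 2 - 4%:R).
Local Notation order := #[coset (pmI F) x]%g.

Let detx : \det (GLval x) = 1.
Proof. by apply/eqP; rewrite -SL2_det. Qed.

Lemma pmI_disc0 : x \in pmI F -> disc = 0.
Proof.
by rewrite inE => /orP[]/eqP ->; rewrite mxtrace2E !mxE /=; ring.
Qed.

Lemma noncentral_semisimpleE : noncentral_semisimple x <-> disc != 0.
Proof.
split=> [[_ _ xss] | disc0].
  apply: contra_neq => disc0; apply/eqP; rewrite coset_pmI_eq1.
  exact: semisimple_disc0 xss disc0.
have x_npmI : x \notin pmI F by apply: contra_neqN disc0; exact: pmI_disc0.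
split=> //; last by rewrite coset_pmI_eq1.
  apply: contra x_npmI => /centerP[_ xC].
  (* Commuting with the upper and lower elementary matrices already forces [x] to be scalar. *)
  have xcomm (M : 'M[F]_2) : \det M = 1 -> GLval x *m M = M *m GLval x.
    move=> detM; have [|u uM] := @GL_lift _ M; first by rewrite detM oner_eq0.
    by rewrite -uM -!GL_MxE xC // SL2_det uM detM.
  have /matrixP xE : GLval x *m mx2 1 1 0 1 = mx2 1 1 0 1 *m GLval x.
    by apply: xcomm; rewrite det2E !mxE /= mulr1 mulr0 subr0.
  have /matrixP xE' : GLval x *m mx2 1 0 1 1 = mx2 1 0 1 1 *m GLval x.
    by apply: xcomm; rewrite det2E !mxE /= mulr1 mul0r subr0.
  apply: (@scalar_SL2_pmI _ _ (GLval x 0 0)) => //.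
  have := xE 0 0; have := xE 0 1; have := xE' 0 0.
  rewrite !mulmx2E !mxE /= !(mulr1, mulr0, mul1r, mul0r, addr0, add0r).
  move=> /eqP; rewrite -subr_eq0 addrAC subrr add0r => /eqP x01.
  move=> /eqP; rewrite x01 addr0 add0r => /eqP x00.
  move=> /eqP; rewrite eq_sym -subr_eq0 addrAC subrr add0r => /eqP x10.
  by apply: mx2P; rewrite !mxE /= ?mulr1n ?mulr0n.
exact: disc_semisimple.
Qed.

Hypothesis disc0 : disc != 0.

Lemma sign_pmI (y : {'GL_2[F]}) (b : bool) :
  GLval y = (if b then 1 else -1)%:M -> y \in pmI F /\ (y == 1%g) = b.
Proof.
move=> yb; split; first by rewrite inE yb; case: b {yb}; rewrite eqxx ?orbT.
apply/eqP/idP => [y1 | b1]; last by apply: GL_inj; rewrite yb b1.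
move: yb; case: b => //; rewrite y1 => /matrixP/(_ 0 0).
by rewrite !mxE /= => /esym/eqP; rewrite (negPf (opp1_neq1 oddF)).
Qed.

Lemma split_half : is_square disc ->
  (x ^+ #|F|./2)%g \in pmI F /\
  (x ^+ #|F|./2 == 1)%g = is_square (\tr (GLval x) + 2%:R).
Proof. by move=> sqD; apply: sign_pmI; rewrite GL_XE sl2_half_expr_split. Qed.

Lemma nonsplit_half : ~~ is_square disc ->
  (x ^+ #|F|./2.+1)%g \in pmI F /\
  (x ^+ #|F|./2.+1 == 1)%g = is_square (\tr (GLval x) + 2%:R).
Proof.
by move=> sqD; apply: sign_pmI; rewrite GL_XE sl2_half_expr_nonsplit.
Qed.

Lemma split_good_order : is_square disc -> (#|F| %% 4)%N = 1%N ->
  good_order_wrt (#|F| - 1) order = is_square (\tr (GLval x) + 2%:R).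
Proof.
move=> sqD q1; have [xh <-] := split_half sqD.
have qE := card_half oddF; set k := #|F|./2 in qE xh *.
rewrite good_order_half //; first by congr (_ ^+ _ == _)%g; lia.
  by lia.
by rewrite (_ : #|F| - 1 = k * 2)%N ?expgM ?pmI_sqr //; lia.
Qed.

Lemma nonsplit_good_order : ~~ is_square disc -> (#|F| %% 4)%N = 3%N ->
  good_order_wrt (#|F| + 1) order = is_square (\tr (GLval x) + 2%:R).
Proof.
move=> sqD q1; have [xh <-] := nonsplit_half sqD.
have qE := card_half oddF; set k := #|F|./2 in qE xh *.
rewrite good_order_half //; first by congr (_ ^+ _ == _)%g; lia.
  by lia.
by rewrite (_ : #|F| + 1 = k.+1 * 2)%N ?expgM ?pmI_sqr //; lia.
Qed.

(** The order divides half of [#|F| + 1], which is odd in this congruence class. *)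
Lemma nonsplit_good_order1 : ~~ is_square disc -> (#|F| %% 4)%N = 1%N ->
  good_order_wrt (#|F| + 1) order.
Proof.
move=> sqD q1; have [xh _] := nonsplit_half sqD.
have qE := card_half oddF; set k := #|F|./2 in qE xh *.
rewrite -order_coset_dvd in xh; have k_odd : odd k.+1 by lia.
rewrite /good_order_wrt (dvdn_odd xh) //=.
by rewrite (_ : #|F| + 1 = k.+1 * 2)%N ?dvdn_mulr //; lia.
Qed.

Lemma q_good_orderE : q_good_order #|F| x <->
  if is_square disc then good_order_wrt (#|F| - 1) order
  else good_order_wrt (#|F| + 1) order.
Proof.
have nsE := is_nonsplitE oddF detx.
case: ifPn => sqD; split=> [[[xs xg] | [xn xg]] | xg] //.
- by move: xn; rewrite nsE sqD.
- by left; split=> //; apply: square_is_split.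
- by move: sqD; rewrite is_split_square.
- by right; split=> //; apply/nsE.
Qed.

Let trace_squares :
  [/\ is_square disc
        = (is_square (\tr (GLval x) - 2%:R) == is_square (\tr (GLval x) + 2%:R))
    & is_square (- \tr (GLval x) - 2%:R)
        = ((#|F| %% 4 == 1)%N == is_square (\tr (GLval x) + 2%:R))].
Proof.
have discE : disc = (\tr (GLval x) - 2%:R) * (\tr (GLval x) + 2%:R) by ring.
move: disc0; rewrite discE mulf_eq0 negb_or => /andP[a0 b0].
split; first by rewrite is_squareM.
rewrite -opprD -mulN1r is_squareM ?is_squareN1 //.
by rewrite oppr_eq0 oner_eq0.
Qed.

Hypothesis F3 : (3 < #|F|)%N.

(** As -1 is a square, the criterion asks that t - 2 or t + 2 be a square, t being the trace. In the
    split case they are squares together. In the non-split case exactly one is, so both sides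
    hold. *)
Lemma psl_commutator_mod1 : (#|F| %% 4)%N = 1%N ->
  psl_commutator (coset (pmI F) x) <-> q_good_order #|F| x.
Proof.
move=> q1; rewrite psl_commutatorP // q_good_orderE.
have [discE ->] := trace_squares; rewrite q1 eqxx.
case: ifPn => sqD.
  rewrite split_good_order //; move: sqD; rewrite discE => /eqP ->.
  by case: (is_square _).
rewrite nonsplit_good_order1 //; move: sqD; rewrite discE.
by case: (is_square _); case: (is_square _).
Qed.

(** As -1 is not a square, exactly one of t + 2 and - t - 2 is, t being the trace. In the split case
    t - 2 has the class of t + 2, so the criterion always holds. In the non-split case it has that
    of - t - 2, so the criterion fails exactly when t + 2 is a square. *)
Lemma psl_commutator_mod3 : (#|F| %% 4)%N = 3%N ->
  ~ psl_commutator (coset (pmI F) x) <-> is_nonsplit x /\ q_good_order #|F| x.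
Proof.
move=> q3; rewrite psl_commutatorP // q_good_orderE (is_nonsplitE oddF detx).
have [discE ->] := trace_squares; rewrite q3 /=.
case: ifPn => sqD.
  move: sqD; rewrite discE => /eqP ->.
  by case: (is_square _); split=> [[] | []].
rewrite nonsplit_good_order //; move: sqD; rewrite discE.
by case: (is_square _); case: (is_square _); split=> // -[].
Qed.

End Orders.

(** The trace is 2 or -2, so one of the two quantities in the criterion is 0, a square. *)
Lemma disc0_commutator (F : finFieldType) (x : {'GL_2[F]}) :
    odd #|F| -> (3 < #|F|)%N -> x \in SL2 F ->
    \tr (GLval x) ^+ 2 - 4%:R = 0 ->
  psl_commutator (coset (pmI F) x).
Proof.
move=> oddF F3 xS disc0; apply/psl_commutatorP => //.
have sq0 : is_square (0 : F) by apply/is_squareP; exists 0; rewrite expr0n.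
have : (\tr (GLval x) - 2%:R) * (- \tr (GLval x) - 2%:R) = 0.
  by rewrite -oppr0 -disc0; ring.
by move/eqP; rewrite mulf_eq0 => /orP[]/eqP->; rewrite sq0 ?orbT.
Qed.

Local Close Scope ring_scope.

Theorem proposition5p4 (q : nat) (F : finFieldType) (hF : #|F| = q)
    (hodd : odd q) (hq : 3 < q)
    (g : coset_of (pmI F)) (hg : g \in PSL2 F) :
  ~ (exists s u : coset_of (pmI F),
       [/\ psl_semisimple s, psl_unipotent u
         & g = (s * u * s^-1 * u^-1)%g])
  <->
  (q = 1 %[mod 4] /\
     exists x : {'GL_2[F]},
       [/\ noncentral_semisimple x, g = coset (pmI F) x & q_bad_order q x])
  \/
  (q = 3 %[mod 4] /\
     exists x : {'GL_2[F]},
       [/\ noncentral_semisimple x, is_nonsplit x, g = coset (pmI F) x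
         & q_good_order q x]).
Proof.
subst q; rewrite -/(psl_commutator g).
have /morphimP[z _ zS gz] := hg.
split=> [ncomm | ].
  have disc0 : (\tr (GLval z) ^+ 2 - 4%:R != 0)%R.
    by apply/eqP => disc0; apply: ncomm; rewrite gz; apply: disc0_commutator.
  have zss : noncentral_semisimple z by apply/noncentral_semisimpleE.
  have [q1 | q3] : #|F| %% 4 = 1 \/ #|F| %% 4 = 3 by lia.
    left; split=> //; exists z; split=> // zgood; apply: ncomm.
    by rewrite gz; apply/psl_commutator_mod1.
  right; split=> //; exists z.
  by move: ncomm; rewrite gz psl_commutator_mod3 // => -[].
(* The lift [x] given here need not be [z], so its membership in [SL2] is recovered from
   [noncentral_semisimple]. *)
case=> -[qmod [x]].
  move=> [xss -> xbad] comm; apply: xbad; have [xS _ _ _] := xss.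
  by apply/psl_commutator_mod1 => //; apply/noncentral_semisimpleE.
move=> [xss xns -> xgood]; have [xS _ _ _] := xss.
by apply/psl_commutator_mod3 => //; apply/noncentral_semisimpleE.
Qed.
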